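(* Let $G$ be an $(r,s)$-directed hypergraph and let $p,q\ge1$ be real numbers with $r/p+s/q>1$. (a) There exists an induced sub-dirhypergraph $G'$ of the bipartite split $\mathcal B(G)$ which admits a hyperbolic consistent $\alpha$-normal labeling with $\alpha=\big(r^{r/p}s^{s/q}\lambda_{p,q}(G)\big)^{-1}$. (b) Conversely, $$\lambda_{p,q}(G)=\frac{1}{r^{r/p}s^{s/q}}\max_i\{\alpha_i^{-1}\},$$ where the maximum is taken over all $\alpha_i$ such that some induced sub-dirhypergraph of $\mathcal B(G)$ admits a hyperbolic consistent $\alpha_i$-normal labeling.
   Context: Let $r,s$ be positive integers. An $(r,s)$-directed hypergraph $G$ consists of a finite vertex set $V(G)$ and a finite set $E(G)$ of arcs. Each arc $e$ is an ordered pair $(T(e),H(e))$ of disjoint subsets of $V(G)$ (tail and head) with $|T(e)|=r$ and $|H(e)|=s$. Write $T(G)=\bigcup_eT(e)$ and $H(G)=\bigcup_eH(e)$. For real vectors $\mathbf{x}=(x_u)_{u\in T(G)}$ and $\mathbf{y}=(y_v)_{v\in H(G)}$, indexed independently, set $P_G(\mathbf x,\mathbf y)=\sum_{e\in E(G)}\prod_{u\in T(e)}x_u\prod_{v\in H(e)}y_v$. For real $p,q\ge1$ let $\lambda_{p,q}(G)=\max\{P_G(\mathbf x,\mathbf y):\|\mathbf x\|_p=\|\mathbf y\|_q=1\}$. The bipartite split $\mathcal B(G)$ is the $(r,s)$-directed hypergraph defined as follows: - its vertex set is $V_T\,\dot\cup\, V_H$, where $V_T$ is a copy of $T(G)$ and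 $V_H$ is a disjoint copy of $H(G)$; - for each arc $e$ of $G$ it has one arc whose tail is the copy of $T(e)$ in $V_T$ and whose head is the copy of $H(e)$ in $V_H$. For $S\subseteq V_T\cup V_H$, the induced sub-dirhypergraph $\mathcal B(G)[S]$ has vertex set $S$ and all arcs of $\mathcal B(G)$ whose tail and head lie in $S$. A weighted incidence matrix of an $(r,s)$-directed hypergraph $G'$ is a matrix $B=(B(v,e))_{v\in V(G'),e\in E(G')}$ with $B(v,e)>0$ if $v\in T(e)\cup H(e)$ and $B(v,e)=0$ otherwise. With $r/p+s/q>1$, a hyperbolic $\alpha$-normal labeling of $G'$ is a weighted incidence matrix $B$ together with positive arc weights $w(e)$ such that: (1) $\sum_{e\in E(G')}w(e)=1$; (2) $\sum_{e:\,u\in T(e)}B(u,e)=1$ for all $u\in T(G')$, and $\sum_{e:\,v\in H(e)}B(v,e)=1$ for all $v\in H(G')$; (3) $w(e)^{1-(r/p+s/q)}\prod_{u\in T(e)}B(u,e)^{1/p}\prod_{v\in H(e)}B(v,e)^{1/q}=\alpha$ for every arc $e$. It is consistent if: - for each $u\in T(G')$, the ratio $w(e)/B(u,e)$ is the same for all arcs $e$ with $u\in T(e)$; - for each $v\in H(G')$, the ratio $w(f)/B(v,f)$ is the same for all arcs $f$ with $v\in H(f)$. *)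

(* Defs.v *)
From HB Require Import structures.
From mathcomp Require Import all_boot all_order all_algebra.
From mathcomp Require Import all_classical all_reals all_analysis.

Set Implicit Arguments.
Unset Strict Implicit.
Unset Printing Implicit Defensive.

Import Order.TTheory GRing.Theory Num.Theory.
Local Open Scope ring_scope.

(* An arc is the ordered pair (tail, head). *)
Notation darc V := ({set V} * {set V})%type.
Notation arctail e := (fst e) (only parsing).
Notation archead e := (snd e) (only parsing).

(* The carrier V is ambient: the vertex set is the subset vset of it, so that *)
(* an induced sub-dirhypergraph lives on the same carrier.                    *)
Record dirhypergraph (r s : nat) (V : finType) := DirHypergraph {
  vset : {set V};
  arcs : {set darc V};
  arcsP : [forall e in arcs,
    [&& arctail e \subset vset, archead e \subset vset,
        [disjoint arctail e & archead e],
        #|arctail e| == r & #|archead e| == s]]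
}.

Section Hypergraph.
Context (r s : nat) (V : finType).
Implicit Types G : dirhypergraph r s V.

Definition tails G : {set V} := \bigcup_(e in arcs G) arctail e.
Definition heads G : {set V} := \bigcup_(e in arcs G) archead e.

Definition induced_arcs G (S : {set V}) : {set darc V} :=
  [set e in arcs G | (arctail e \subset S) && (archead e \subset S)].

Lemma induced_arcsP G (S : {set V}) : [forall e in induced_arcs G S,
  [&& arctail e \subset vset G :&: S, archead e \subset vset G :&: S,
      [disjoint arctail e & archead e], #|arctail e| == r & #|archead e| == s]].
Proof.
apply/forallP => e; apply/implyP; rewrite inE => /and3P[eG tS hS].
move/forallP/(_ e): (arcsP G); rewrite eG /= => /and5P[tG hG -> -> ->].
by rewrite !finset.subsetI tG hG tS hS.
Qed.

(* Only used with S \subset vset G, in which case the vertex set is S. *)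
Definition induced_sub G (S : {set V}) : dirhypergraph r s V :=
  DirHypergraph (induced_arcsP G S).

(* The copies of T(G) and H(G) are taken in the two summands of V + V. *)
Definition split_arc (e : darc V) : darc (V + V)%type :=
  (inl @: arctail e, inr @: archead e).

Definition split_vset G : {set V + V} := inl @: tails G :|: inr @: heads G.

Lemma bsplit_arcsP G : [forall e in split_arc @: arcs G,
  [&& arctail e \subset split_vset G, archead e \subset split_vset G,
      [disjoint arctail e & archead e], #|arctail e| == r & #|archead e| == s]].
Proof.
apply/forallP => f; apply/implyP => /imsetP[e eG ->] /=.
move/forallP/(_ e): (arcsP G); rewrite eG /= => /and5P[_ _ _ ct ch].
rewrite !card_imset; [|exact: inr_inj|exact: inl_inj].
rewrite ct ch !andbT; apply/and3P; split.
- by apply/finset.subsetU/orP; left; apply/imsetS/finset.bigcup_sup.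
- by apply/finset.subsetU/orP; right; apply/imsetS/finset.bigcup_sup.
- rewrite disjoint_subset; apply/fintype.subsetP => _ /imsetP[u _ ->].
  by rewrite inE; apply/imsetP => -[].
Qed.

Definition bsplit G : dirhypergraph r s (V + V)%type :=
  DirHypergraph (bsplit_arcsP G).

End Hypergraph.

Section Spectral.
Context (R : realType).

Definition is_maximum (A : set R) (m : R) : Prop := A m /\ ubound A m.

Context (r s : nat) (V : finType).
Implicit Types G : dirhypergraph r s V.

(* Vectors indexed by A \subset V are encoded as functions on V whose values *)
(* outside A are never used.                                                 *)
Definition pnorm (A : {set V}) (p : R) (x : V -> R) : R :=
  (\sum_(u in A) `|x u| `^ p) `^ p^-1.

Definition polyform G (x y : V -> R) : R :=
  \sum_(e in arcs G)
    (\prod_(u in arctail e) x u) * (\prod_(v in archead e) y v).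

Definition polyform_values G (p q : R) : set R :=
  [set c | exists x y : V -> R,
    [/\ pnorm (tails G) p x = 1, pnorm (heads G) q y = 1
      & c = polyform G x y]]%classic.

(* The maximum of polyform_values; the default value 0 is only taken when    *)
(* there is no maximum.                                                      *)
Definition lambda G (p q : R) : R :=
  xget 0 [set m | is_maximum (polyform_values G p q) m]%classic.

(* Matrices are encoded as functions on V and all pairs of subsets of V; only *)
(* the entries in vset G and arcs G are constrained.                          *)
Definition weighted_incidence G (B : V -> darc V -> R) : Prop :=
  forall v e, v \in vset G -> e \in arcs G ->
    (v \in arctail e :|: archead e -> 0 < B v e) /\
    (v \notin arctail e :|: archead e -> B v e = 0).

Definition normal_labeling G (p q alpha : R)
    (B : V -> darc V -> R) (w : darc V -> R) : Prop :=
  [/\ weighted_incidence G B,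
      forall e, e \in arcs G -> 0 < w e,
      \sum_(e in arcs G) w e = 1,
      (forall u, u \in tails G ->
         \sum_(e in arcs G | u \in arctail e) B u e = 1) /\
      (forall v, v \in heads G ->
         \sum_(e in arcs G | v \in archead e) B v e = 1)
    & forall e, e \in arcs G ->
        w e `^ (1 - (r%:R / p + s%:R / q))
          * (\prod_(u in arctail e) B u e `^ p^-1)
          * (\prod_(v in archead e) B v e `^ q^-1) = alpha].

Definition consistent G (B : V -> darc V -> R) (w : darc V -> R) : Prop :=
  (forall u e f, u \in tails G -> e \in arcs G -> f \in arcs G ->
     u \in arctail e -> u \in arctail f -> w e / B u e = w f / B u f) /\
  (forall v e f, v \in heads G -> e \in arcs G -> f \in arcs G ->
     v \in archead e -> v \in archead f -> w e / B v e = w f / B v f).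

(* The labeling is called hyperbolic when 1 < r / p + s / q. *)
Definition hyperbolic_consistent_normal G (p q alpha : R) : Prop :=
  1 < r%:R / p + s%:R / q /\
  exists B w, normal_labeling G p q alpha B w /\ consistent G B w.

End Spectral.

(* Main.v *)
(* A maximizer of the polynomial form exists by compactness and may be taken
   nonnegative. Writing [P e] for the monomial of the arc [e] at the maximizer,
   the weights [w e = P e / lambda], restricted to the support, form a
   consistent labeling: the normalization of the rows of [B] is the Lagrange
   condition at the maximizer. Conversely, in a consistent labeling the common
   value of [w e / B u e] is [r * x u `^ p] for a unit vector [x] (and
   similarly for [y]), at which the form is at least
   [alpha^-1 / (r `^ (r / p) * s `^ (s / q))]. *)
Require Import Defs.
From HB Require Import structures.
From mathcomp Require Import all_boot all_order all_algebra.
From mathcomp Require Import all_classical all_reals all_analysis.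
From mathcomp Require Import ring.

Set Implicit Arguments.
Unset Strict Implicit.
Unset Printing Implicit Defensive.

Import Order.TTheory GRing.Theory Num.Theory.
Local Open Scope ring_scope.

Import numFieldNormedType.Exports.

(** * Continuity and stationarity for real powers *)

(** Away from 0 this follows from derivability of the power. At 0, where derivability can fail, the
    radius is chosen explicitly as the power of [e] with exponent [p^-1]. *)
Lemma continuous_norm_powR (R : realType) (p : R) :
  0 < p -> continuous (fun a : R => `|a| `^ p).
Proof.
move=> p_gt0 a; have [->|a_neq0] := eqVneq a 0.
  apply/cvgrPdist_lt => e e_gt0; rewrite normr0 powR0 ?gt_eqF//.
  near=> b; rewrite sub0r normrN ger0_norm ?powR_ge0//.
  have -> : e = (e `^ p^-1) `^ p by rewrite -powRrM mulVf ?gt_eqF// powRr1 ?ltW.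
  apply: gt0_ltr_powR; rewrite ?nnegrE ?powR_ge0//.
  near: b; have e'_gt0 : 0 < e `^ p^-1 by rewrite powR_gt0.
  exists (e `^ p^-1) => //= b /=; by rewrite sub0r normrN.
have cp : {for `|a|, continuous ((@powR R)^~ p)}.
  apply: differentiable_continuous; apply/derivable1_diffP.
  by apply: derivable_powR; rewrite in_itv /= andbT normr_gt0.
exact: (continuous_comp (@norm_continuous _ R a) cp).
Unshelve. all: by end_near. Qed.

(** Both sides take the value [l] at [z = 1], so the affine left side is tangent there to the right
    side; equating slopes gives the conclusion. This is the one-variable form of the Lagrange
    condition. *)
Lemma stationary_powR (R : realType) (p k a l D : R) :
  0 < p -> 0 <= a <= 1 ->
  (forall z, 0 < z -> l + (z - 1) * D <= l * (1 - a + a * z `^ p) `^ k) ->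
  D = l * (k * (a * p)).
Proof.
move=> p_gt0 /andP[a_ge0 a_le1] le_l.
pose b z := 1 - a + a * z `^ p.
have b_gt0 z : 0 < z -> 0 < b z.
  move=> z_gt0; have zp : 0 < z `^ p by rewrite powR_gt0.
  rewrite /b; have [->|a0] := eqVneq a 0; first by rewrite subr0 mul0r addr0.
  by apply: ltr_wpDl; rewrite ?subr_ge0// mulr_gt0// lt_neqAle eq_sym a0.
pose f z := l * b z `^ k - D * (z - 1).
have b_drv (z : R) : 0 < z -> is_derive z 1 b (a * (p * z `^ (p - 1))).
  move=> z_gt0.
  have := is_derive1_powR p z_gt0 => dp.
  have := is_deriveD (is_derive_cst (1 - a) z 1) (is_deriveZ a dp).
  by rewrite add0r.
have f_drv (z : R) : 0 < z ->
    is_derive z 1 f (l * (k * b z `^ (k - 1) * (a * (p * z `^ (p - 1)))) - D).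
  move=> z_gt0.
  have db := b_drv z z_gt0.
  have dk := is_derive1_powR k (b_gt0 z z_gt0).
  have dc := is_deriveZ l (is_derive1_comp dk db).
  have dd := is_deriveZ D (is_deriveB (is_derive_id z 1)
    (is_derive_cst (1 : R) z 1)).
  have := is_deriveB dc dd.
  by rewrite subr0 /GRing.scale /= mulr1.
have f_min : is_derive (1 : R) 1 f 0.
  (* The interval from 0 to 2 is a neighbourhood of 1 inside the positive reals, where the
     inequality is assumed and [b] is positive. *)
  apply: (@derive1_at_min _ f 0 2) => //.
  - by move=> t /andP[]; rewrite bnd_simp => /f_drv [].
  - by rewrite in_itv /= ltr01 ltr1n.
  - move=> t /andP[]; rewrite bnd_simp => t_gt0 _.
    rewrite /f /b powR1 mulr1 subrK powR1 mulr1 subrr mulr0 subr0.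
    by rewrite lerBrDr [D * _]mulrC; exact: le_l.
have [_ f1_eq0] := f_min; have [_] := f_drv 1 ltr01; rewrite f1_eq0 => /esym.
rewrite /b !powR1 !mulr1 subrK powR1 mulr1 => /eqP.
by rewrite subr_eq0 => /eqP <-.
Qed.

(** * Normalized vectors and the Lagrange condition *)

Lemma pnorm_eq1 (R : realType) (V : finType) (A : {set V}) (p : R)
    (x : V -> R) : 0 < p ->
  pnorm A p x = 1 <-> \sum_(u in A) `|x u| `^ p = 1.
Proof.
move=> p_gt0; rewrite /pnorm; split=> [/eqP|->]; last by rewrite powR1.
rewrite powR_eq1 invr_eq0 (gt_eqF p_gt0) orbF => /orP[/eqP//|].
(* A real power of a negative base is 1 by convention, so a negative sum has to be excluded as
   well. *)
by rewrite ltNge sumr_ge0// => u _; rewrite powR_ge0.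
Qed.

Lemma normalize_sum_powR (R : realType) (V : finType) (A : {set V}) (p N : R)
    (x : V -> R) : 0 < p -> 0 < N -> \sum_(u in A) `|x u| `^ p = N ->
  \sum_(u in A) `|N `^ (- p^-1) * x u| `^ p = 1.
Proof.
move=> p_gt0 N_gt0 sumx.
under eq_bigr => u _.
  rewrite normrM powRM// ger0_norm ?powR_ge0// -powRrM mulNr mulVf ?gt_eqF//.
  rewrite powR_inv1 ?ltW//; over.
by rewrite -mulr_sumr sumx mulVf ?gt_eqF.
Qed.

(* Scaling the coordinate [u] by [z] changes the form affinely, since it is
   multilinear, and the constraint through [z `^ p]; comparing derivatives at
   [z = 1] replaces the use of a Lagrange multiplier. *)
Lemma multilinear_stationary (R : realType) (V I : finType) (E : {set I})
    (T : I -> {set V}) (r : nat) (A : {set V}) (p : R) (c : I -> R)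
    (x : V -> R) (u : V) :
  0 < p -> (forall e, e \in E -> #|T e| = r) ->
  (forall x', \sum_(v in A) `|x' v| `^ p = 1 ->
     \sum_(e in E) c e * \prod_(v in T e) x' v
       <= \sum_(e in E) c e * \prod_(v in T e) x v) ->
  \sum_(v in A) `|x v| `^ p = 1 -> u \in A ->
  \sum_(e in E | u \in T e) c e * \prod_(v in T e) x v
    = r%:R * `|x u| `^ p * \sum_(e in E) c e * \prod_(v in T e) x v.
Proof.
move=> p_gt0 cardT x_max sumx uA.
set l := \sum_(e in E) _; set D := \sum_(e in E | _) _.
set a := `|x u| `^ p.
have a_ge0 : 0 <= a by rewrite powR_ge0.
have sum_rest : \sum_(v in A | v != u) `|x v| `^ p = 1 - a.
  by move: sumx; rewrite (bigD1 u)//= -/a => <-; rewrite addrAC subrr add0r.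
have a_le1 : a <= 1.
  by rewrite -subr_ge0 -sum_rest sumr_ge0// => v _; rewrite powR_ge0.
(* The exponent [r / p] comes from renormalizing: each of the [r] factors of a monomial is divided
   by the [p]-th root of [N]. *)
suff -> : D = l * (r%:R / p * (a * p)).
  by field; rewrite gt_eqF.
apply: (stationary_powR p_gt0); first by rewrite a_ge0.
move=> z z_gt0.
pose xz v := if v == u then z * x v else x v.
pose N := 1 - a + a * z `^ p.
have N_gt0 : 0 < N.
  have zp_gt0 : 0 < z `^ p by rewrite powR_gt0.
  rewrite /N; have [->|a_neq0] := eqVneq a 0; first by rewrite subr0 mul0r addr0.
  by apply: ltr_wpDl; rewrite ?subr_ge0// mulr_gt0// lt_neqAle eq_sym a_neq0.
have sumxz : \sum_(v in A) `|xz v| `^ p = N.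
  rewrite (bigD1 u)//= {1}/xz eqxx normrM powRM// (gtr0_norm z_gt0) -/a.
  rewrite /N -sum_rest [z `^ p * a]mulrC addrC; congr (_ + _).
  by apply: eq_bigr => v /andP[_ /negPf vu]; rewrite /xz vu.
have form_xz : \sum_(e in E) c e * \prod_(v in T e) xz v = l + (z - 1) * D.
  rewrite /l /D big_mkcondr mulr_sumr -big_split /=; apply: eq_bigr => e _.
  case: ifPn => [ue|une].
    rewrite (bigD1 u)//= {1}/xz eqxx [in RHS](bigD1 u)//=.
    rewrite (eq_bigr x) => [|v /andP[_ /negPf vu]]; last by rewrite /xz vu.
    by ring.
  rewrite mulr0 addr0 (eq_bigr x)// => v ve; rewrite /xz.
  by case: eqVneq => // vu; rewrite -vu ve in une.
rewrite -form_xz -/N.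
have := x_max _ (normalize_sum_powR p_gt0 N_gt0 sumxz).
under eq_bigr => e eE.
  rewrite big_split /= prodr_const cardT// mulrCA; over.
rewrite -mulr_sumr -/l -powR_mulrn ?powR_ge0// -powRrM mulNr powRN.
by rewrite ler_pdivrMl ?powR_gt0// [p^-1 * _]mulrC [l * _]mulrC.
Qed.

(** * Existence of a nonnegative maximizer with positive value *)

Lemma arc_structure (r s : nat) (V : finType) (G : dirhypergraph r s V)
    (e : darc V) : e \in arcs G ->
  [/\ e.1 \subset vset G, e.2 \subset vset G, [disjoint e.1 & e.2],
      #|e.1| = r & #|e.2| = s].
Proof.
move=> eG; move/forallP/(_ e): (arcsP G); rewrite eG /=.
by case/and5P => ? ? ? /eqP ? /eqP ?.
Qed.

Lemma arctail_sub (r s : nat) (V : finType) (G : dirhypergraph r s V)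
    (e : darc V) (u : V) : e \in arcs G -> u \in e.1 -> u \in tails G.
Proof. by move=> eG ue; apply/bigcupP; exists e. Qed.

Lemma archead_sub (r s : nat) (V : finType) (G : dirhypergraph r s V)
    (e : darc V) (v : V) : e \in arcs G -> v \in e.2 -> v \in heads G.
Proof. by move=> eG ve; apply/bigcupP; exists e. Qed.

Lemma norm_le1 (R : realType) (V : finType) (A : {set V}) (p : R)
    (x : V -> R) (u : V) : 0 < p -> u \in A ->
  \sum_(v in A) `|x v| `^ p = 1 -> `|x u| <= 1.
Proof.
move=> p_gt0 uA sumx; rewrite leNgt; apply/negP => x_gt1.
have : `|x u| `^ p <= 1.
  by rewrite -sumx (bigD1 u)//= lerDl sumr_ge0// => v _; rewrite powR_ge0.
have := gt0_ltr_powR p_gt0 _ _ x_gt1; rewrite !nnegrE ler01 normr_ge0 powR1.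
by move=> /(_ isT isT) ?; rewrite leNgt; apply/negP/negPn.
Qed.

(** A constant vector suffices. Such vectors provide a feasible point and show that the maximum of
    the form is positive. *)
Lemma exists_positive_unit_vector (R : realType) (V : finType) (A : {set V})
    (p : R) : 0 < p -> (0 < #|A|)%N ->
  exists2 x : V -> R, forall u, 0 < x u & \sum_(u in A) `|x u| `^ p = 1.
Proof.
move=> p_gt0 A_gt0; have N_gt0 : 0 < #|A|%:R :> R by rewrite ltr0n.
exists (fun u => #|A|%:R `^ (- p^-1) * 1).
  by move=> u; rewrite mulr1 powR_gt0.
apply: (normalize_sum_powR p_gt0 N_gt0).
by under eq_bigr do rewrite normr1 powR1; rewrite sumr_const.
Qed.

(** Replacing coordinates by their absolute values does not decrease the form, and the coordinates
    of a unit vector have absolute value at most 1. It therefore suffices to maximize over a closed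
    subset of a cube, which is compact by Tychonoff's theorem. *)
Lemma exists_maximizer (R : realType) (r s : nat) (V : finType)
    (G : dirhypergraph r s V) (p q : R) :
  0 < p -> 0 < q -> (0 < r)%N -> (0 < s)%N -> (0 < #|arcs G|)%N ->
  exists x y : V -> R,
    [/\ (forall u, 0 <= x u) /\ (forall v, 0 <= y v),
        pnorm (tails G) p x = 1, pnorm (heads G) q y = 1,
        forall x' y', pnorm (tails G) p x' = 1 -> pnorm (heads G) q y' = 1 ->
          polyform G x' y' <= polyform G x y
      & 0 < polyform G x y].
Proof.
move=> p_gt0 q_gt0 r_gt0 s_gt0 /card_gt0P[e0 e0G].
(* A pair of vectors is encoded as one point of a product indexed by [V + V]. *)
pose T := prod_topology (fun _ : V + V => R).
have coord_cont (i : V + V) : continuous (fun f : T => f i).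
  exact: (@proj_continuous _ (fun _ => R) i).
pose sT (f : T) := \sum_(u in tails G) `|f (inl u)| `^ p.
pose sH (f : T) := \sum_(v in heads G) `|f (inr v)| `^ q.
have sT_cont : continuous sT.
  apply: continuous_big => [|u _ f]; first exact: add_continuous.
  apply: (@continuous_comp T R R (fun g : T => g (inl u))
    (fun a : R => `|a| `^ p)).
    exact: coord_cont.
  exact: continuous_norm_powR.
have sH_cont : continuous sH.
  apply: continuous_big => [|v _ f]; first exact: add_continuous.
  apply: (@continuous_comp T R R (fun g : T => g (inr v))
    (fun a : R => `|a| `^ q)).
    exact: coord_cont.
  exact: continuous_norm_powR.
pose F (f : T) := polyform G (fun u => f (inl u)) (fun v => f (inr v)).
have prod_cont (A : {set V}) (i : V -> V + V) :
    continuous (fun f : T => \prod_(u in A) f (i u)).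
  by apply: continuous_big => [|u _]; [exact: mul_continuous|exact: coord_cont].
have F_cont : continuous F.
  apply: continuous_big => [|e _ f]; first exact: add_continuous.
  exact: (@continuousM R T (fun g => \prod_(u in e.1) g (inl u))
    (fun g => \prod_(v in e.2) g (inr v)) f (prod_cont _ _ f) (prod_cont _ _ f)).
pose box : set T := [set f | forall i, `[0, 1]%classic (f i)]%classic.
pose C : set T := (box `&` (sT @^-1` [set 1]) `&` (sH @^-1` [set 1]))%classic.
have box_compact : compact box.
  apply: (@tychonoff _ (fun _ : V + V => R) (fun _ => `[0, 1]%classic)) => i.
  exact: segment_compact.
have C_compact : compact C.
  apply: (subclosed_compact _ box_compact); last by move=> f [[]].
  apply: closedI; first apply: closedI.
  - apply: compact_closed box_compact.
    exact: (@hausdorff_product _ (fun _ => R)).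
  - by move/continuous_closedP: sT_cont; apply; exact: closed_eq.
  - by move/continuous_closedP: sH_cont; apply; exact: closed_eq.
(* Coordinates outside the tails or heads are unconstrained by the norms and never enter the form;
   setting them to 0 brings the point into the cube. *)
pose trunc (x y : V -> R) : T := fun i => match i with
  | inl u => if u \in tails G then `|x u| else 0
  | inr v => if v \in heads G then `|y v| else 0 end.
have truncP x y : pnorm (tails G) p x = 1 -> pnorm (heads G) q y = 1 ->
    C (trunc x y) /\ polyform G x y <= F (trunc x y).
  move=> /(pnorm_eq1 _ _ p_gt0) sumx /(pnorm_eq1 _ _ q_gt0) sumy.
  split; first split; first split.
  - move=> [u|v] /=; rewrite in_itv /=.
      by case: ifP => uT; rewrite ?lexx ?ler01// normr_ge0 (norm_le1 p_gt0 uT).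
    by case: ifP => vH; rewrite ?lexx ?ler01// normr_ge0 (norm_le1 q_gt0 vH).
  - by rewrite /= /sT -sumx; apply: eq_bigr => u uT; rewrite /= uT normr_id.
  - by rewrite /= /sH -sumy; apply: eq_bigr => v vH; rewrite /= vH normr_id.
  apply: ler_sum => e eG; apply: le_trans (ler_norm _) _.
  rewrite normrM !normr_prod le_eqVlt; apply/orP; left; apply/eqP.
  congr (_ * _).
    by apply: eq_bigr => u ue; rewrite /= (arctail_sub eG ue).
  by apply: eq_bigr => v ve; rewrite /= (archead_sub eG ve).
have [_ _ _ card_e1 card_e2] := arc_structure e0G.
have [|x0 x0_gt0 /(pnorm_eq1 _ _ p_gt0) x0_norm] :=
    exists_positive_unit_vector (A := tails G) p_gt0.
  have /card_gt0P[u ue] : (0 < #|e0.1|)%N by rewrite card_e1.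
  by apply/card_gt0P; exists u; exact: arctail_sub ue.
have [|y0 y0_gt0 /(pnorm_eq1 _ _ q_gt0) y0_norm] :=
    exists_positive_unit_vector (A := heads G) q_gt0.
  have /card_gt0P[v ve] : (0 < #|e0.2|)%N by rewrite card_e2.
  by apply/card_gt0P; exists v; exact: archead_sub ve.
have [|||f /set_mem[[f_box /= fT] /= fH] f_max] := @compact_EVT_max T R F C.
- by exists (trunc x0 y0); have [] := truncP _ _ x0_norm y0_norm.
- exact: C_compact.
- exact: continuous_subspaceT.
have F_max x y : pnorm (tails G) p x = 1 -> pnorm (heads G) q y = 1 ->
    polyform G x y <= F f.
  move=> nx ny; have [Cxy /le_trans] := truncP _ _ nx ny; apply.
  by apply: f_max; exact: mem_set.
exists (fun u => f (inl u)), (fun v => f (inr v)).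
have f_ge0 i : 0 <= f i by have := f_box i; rewrite /= in_itv /= => /andP[].
split; [by split=> ?; exact: f_ge0| | |exact: F_max|].
- exact: ((pnorm_eq1 (tails G) (fun u => f (inl u)) p_gt0).2 fT).
- exact: ((pnorm_eq1 (heads G) (fun v => f (inr v)) q_gt0).2 fH).
(* At the positive vectors [x0] and [y0] the arc [e0] alone already contributes a positive term. *)
apply: lt_le_trans (F_max _ _ x0_norm y0_norm).
rewrite /polyform (bigD1 e0)//= ltr_pwDl//.
  by rewrite mulr_gt0// prodr_gt0.
by apply: sumr_ge0 => e _; rewrite mulr_ge0// prodr_ge0// => ? _; exact: ltW.
Qed.

(** * From consistent labelings to unit vectors *)

Lemma powRV (R : realType) (x a : R) : 0 <= x -> x^-1 `^ a = (x `^ a)^-1.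
Proof. by move=> x_ge0; rewrite -!powR_inv1 ?powR_ge0// powRAC. Qed.

(** Double counting: each [e] contributes [g e] once for each of its [k] elements. *)
Lemma sum_incidence (R : nmodType) (V I : finType) (E : {set I})
    (T : I -> {set V}) (k : nat) (A : {set V}) (g : I -> R) :
  (forall e, e \in E -> #|T e| = k) -> (forall e, e \in E -> T e \subset A) ->
  \sum_(u in A) \sum_(e in E | u \in T e) g e = (\sum_(e in E) g e) *+ k.
Proof.
move=> cardT subT.
rewrite (exchange_big_dep (mem E))/= => [|u e _ /andP[]//].
rewrite -sumrMnl; apply: eq_bigr => e eE.
rewrite (eq_bigl (mem (T e))) => [|u]; first by rewrite sumr_const cardT.
rewrite eE /=; case: (boolP (u \in T e)) => [|_]; last by rewrite andbF.
by rewrite andbT => /(fintype.subsetP (subT e eE)).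
Qed.

Lemma prod_powR_const (R : realType) (V : finType) (T : {set V}) (k : nat)
    (a p : R) : #|T| = k ->
  \prod_(u in T) a `^ p^-1 = a `^ (k%:R / p).
Proof.
by move=> cardT; rewrite prodr_const cardT -powR_mulrn ?powR_ge0// -powRrM mulrC.
Qed.

(** Serves both directions: with [a] the weight of an arc, [b] is the labeling when the vector is
    recovered from it, and the [p]-th power of the vector when the labeling is built. *)
Lemma prod_edge_weight (R : realType) (V : finType) (T : {set V}) (k : nat)
    (a p : R) (b : V -> R) : 0 <= a -> #|T| = k ->
    (forall u, u \in T -> 0 <= b u) ->
  \prod_(u in T) (a / (k%:R * b u)) `^ p^-1
    = a `^ (k%:R / p) / (k%:R `^ (k%:R / p) * \prod_(u in T) b u `^ p^-1).
Proof.
move=> a_ge0 cardT b_ge0.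
under eq_bigr => u uT.
  have bu := b_ge0 u uT.
  rewrite powRM ?invr_ge0 ?mulr_ge0// powRV ?mulr_ge0// powRM//; over.
by rewrite big_split prodfV big_split /= !(prod_powR_const _ _ cardT).
Qed.

(** By consistency the weights at [u] are proportional to the entries [B u f], which sum to 1, so
    the common ratio is the total weight at [u]. Dividing it by [k] gives the [p]-th power of [x u];
    double counting then makes these powers sum to 1. *)
Lemma labeling_unit_vector (R : realType) (V I : finType) (E : {set I})
    (T : I -> {set V}) (k : nat) (A : {set V}) (p : R) (B : V -> I -> R)
    (w : I -> R) :
  0 < p -> (0 < k)%N ->
  (forall e, e \in E -> #|T e| = k) -> (forall e, e \in E -> T e \subset A) ->
  (forall e, e \in E -> 0 < w e) -> \sum_(e in E) w e = 1 ->
  (forall u e, e \in E -> u \in T e -> 0 < B u e) ->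
  (forall u e, e \in E -> u \in T e -> \sum_(f in E | u \in T f) B u f = 1) ->
  (forall u e f, e \in E -> f \in E -> u \in T e -> u \in T f ->
     w e / B u e = w f / B u f) ->
  exists x : V -> R,
    [/\ forall u, 0 <= x u, \sum_(u in A) `|x u| `^ p = 1 &
        forall e, e \in E -> \prod_(u in T e) x u =
          w e `^ (k%:R / p)
            / (k%:R `^ (k%:R / p) * \prod_(u in T e) B u e `^ p^-1)].
Proof.
move=> p_gt0 k_gt0 cardT subT w_gt0 sumw B_gt0 sumB cons.
have k_neq0 : k%:R != 0 :> R by rewrite pnatr_eq0 -lt0n.
(* Defining [X] by a sum instead of a ratio makes it vanish at vertices that no [T e] covers, so the
   vector extends by 0 to all of [A]. *)
pose X u := (\sum_(f in E | u \in T f) w f) / k%:R.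
have X_ge0 u : 0 <= X u.
  by rewrite divr_ge0// sumr_ge0// => f /andP[/w_gt0/ltW].
have XE u e : e \in E -> u \in T e -> X u = w e / (k%:R * B u e).
  move=> eE ue; rewrite /X (eq_bigr (fun f => w e / B u e * B u f)).
    by rewrite -mulr_sumr (sumB u e)// mulr1 invfM mulrA mulrAC.
  move=> f /andP[fE uf]; rewrite (cons u e f)// mulfVK// gt_eqF//.
  exact: B_gt0.
exists (fun u => X u `^ p^-1); split=> [u||e eE].
- exact: powR_ge0.
- under eq_bigr => u _.
    rewrite ger0_norm ?powR_ge0// -powRrM mulVf ?gt_eqF// powRr1//; over.
  by rewrite -mulr_suml (sum_incidence _ cardT)// sumw divff.
- rewrite (eq_bigr (fun u => (w e / (k%:R * B u e)) `^ p^-1)).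
    rewrite prod_edge_weight ?cardT//; first exact/ltW/w_gt0.
    by move=> u ue; exact/ltW/B_gt0.
  by move=> u ue; rewrite (XE u e).
Qed.

(** At the vectors read off from the labeling, condition (3) turns each monomial of the
    sub-dirhypergraph into a fixed multiple of [w e]. The weights sum to 1, and the remaining arcs
    of [G] contribute nonnegative terms. *)
Lemma labeling_le_polyform (R : realType) (r s : nat) (V : finType)
    (G : dirhypergraph r s V) (S : {set V}) (p q alpha : R)
    (B : V -> darc V -> R) (w : darc V -> R) :
  0 < p -> 0 < q -> (0 < r)%N -> (0 < s)%N ->
  normal_labeling (induced_sub G S) p q alpha B w ->
  consistent (induced_sub G S) B w ->
  exists x y : V -> R,
    [/\ pnorm (tails G) p x = 1, pnorm (heads G) q y = 1 &
        alpha^-1 <= r%:R `^ (r%:R / p) * s%:R `^ (s%:R / q) * polyform G x y].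
Proof.
move=> p_gt0 q_gt0 r_gt0 s_gt0 [incB w_gt0 sumw [sumBT sumBH] prodB] [consT consH].
set G' := induced_sub G S in incB w_gt0 sumw sumBT sumBH prodB consT consH.
have G'G e : e \in arcs G' -> e \in arcs G by rewrite inE => /andP[].
have B_gt0 u e : e \in arcs G' -> u \in e.1 :|: e.2 -> 0 < B u e.
  move=> eG' ue; have [sub1 sub2 _ _ _] := arc_structure eG'.
  apply: (incB u e _ eG').1 => //.
  by case/setUP: ue => [/(fintype.subsetP sub1)|/(fintype.subsetP sub2)].
have [|||||x [x_ge0 sumx prodx]] := @labeling_unit_vector R V _ (arcs G')
    (fun e => e.1) r (tails G) p B w p_gt0 r_gt0 _ _ w_gt0 sumw.
- by move=> e /arc_structure[].
- by move=> e /G'G eG; apply/fintype.subsetP => u; exact: arctail_sub.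
- by move=> u e eG' ue; rewrite B_gt0// inE ue.
- by move=> u e eG' ue; rewrite sumBT//; exact: arctail_sub ue.
- by move=> u e f eG' fG' ue uf; apply: consT => //; exact: arctail_sub ue.
have [|||||y [y_ge0 sumy prody]] := @labeling_unit_vector R V _ (arcs G')
    (fun e => e.2) s (heads G) q B w q_gt0 s_gt0 _ _ w_gt0 sumw.
- by move=> e /arc_structure[].
- by move=> e /G'G eG; apply/fintype.subsetP => u; exact: archead_sub.
- by move=> u e eG' ue; rewrite B_gt0// inE ue orbT.
- by move=> u e eG' ue; rewrite sumBH//; exact: archead_sub ue.
- by move=> u e f eG' fG' ue uf; apply: consH => //; exact: archead_sub ue.
exists x, y; split; [exact/pnorm_eq1|exact/pnorm_eq1|].
set C := _ * _ `^ _.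
have C_gt0 : 0 < C by rewrite mulr_gt0// powR_gt0// ltr0n.
have termE e : e \in arcs G' ->
    C * (\prod_(u in e.1) x u * \prod_(v in e.2) y v) = w e * alpha^-1.
  move=> eG'; rewrite prodx// prody// -(prodB e eG').
  have we := w_gt0 e eG'.
  have w0 : w e != 0 by rewrite gt_eqF.
  rewrite powRB ?w0 ?implybT// powRr1 ?(ltW we)// powRD ?w0 ?implybT//.
  have b1 : \prod_(u in e.1) B u e `^ p^-1 != 0.
    by rewrite gt_eqF// prodr_gt0// => u ue; rewrite powR_gt0// B_gt0// inE ue.
  have b2 : \prod_(u in e.2) B u e `^ q^-1 != 0.
    by rewrite gt_eqF// prodr_gt0// => u ue; rewrite powR_gt0// B_gt0// inE ue orbT.
  have rr : r%:R `^ (r%:R / p) != 0 :> R by rewrite gt_eqF// powR_gt0// ltr0n.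
  have ss : s%:R `^ (s%:R / q) != 0 :> R by rewrite gt_eqF// powR_gt0// ltr0n.
  have wr : w e `^ (r%:R / p) != 0 by rewrite gt_eqF// powR_gt0.
  have ws : w e `^ (s%:R / q) != 0 by rewrite gt_eqF// powR_gt0.
  (* Once the powers and products are generalized to nonzero atoms, the claim is an identity of
     rational expressions. *)
  rewrite /C; move: b1 b2 rr ss wr ws w0.
  move: (\prod_(_ in e.1) _) (\prod_(_ in e.2) _) (r%:R `^ _) (s%:R `^ _).
  move: (w e `^ (r%:R / p)) (w e `^ (s%:R / q)) (w e) => a1 a2 a3 a4 a5 a6 a7.
  by move=> *; field; do ?[apply/andP; split].
have -> : alpha^-1 = \sum_(e in arcs G') w e * alpha^-1.
  by rewrite -mulr_suml sumw mul1r.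
rewrite -(eq_bigr _ termE) -mulr_sumr ler_pM2l//.
rewrite /polyform [leRHS](bigID (mem (arcs G')))/=.
rewrite [X in _ <= X + _](eq_bigl (mem (arcs G'))) => [|e]; last first.
  by apply/andP/idP => [[]//|eG']; rewrite (G'G e eG').
rewrite lerDl sumr_ge0// => e _.
by rewrite mulr_ge0// prodr_ge0.
Qed.

(** * From a maximizer to a consistent labeling *)

(** On the support of the maximizer, stationarity gives total weight [r] times the [p]-th power of
    [x u] at each tail vertex [u], and symmetrically at heads. Dividing [w e] by this total defines
    [B], so rows sum to 1 and the ratio [w e / B u e] depends only on [u]. *)
Lemma maximizer_labeling (R : realType) (r s : nat) (V : finType)
    (G : dirhypergraph r s V) (p q : R) (x y : V -> R) :
  0 < p -> 0 < q -> (0 < r)%N -> (0 < s)%N ->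
  tails G \subset vset G -> heads G \subset vset G ->
  [disjoint tails G & heads G] ->
  (forall u, 0 <= x u) -> (forall v, 0 <= y v) ->
  pnorm (tails G) p x = 1 -> pnorm (heads G) q y = 1 ->
  (forall x' y', pnorm (tails G) p x' = 1 -> pnorm (heads G) q y' = 1 ->
     polyform G x' y' <= polyform G x y) ->
  0 < polyform G x y ->
  exists2 S : {set V}, S \subset vset G &
    exists B w, normal_labeling (induced_sub G S) p q
        (r%:R `^ (r%:R / p) * s%:R `^ (s%:R / q) * polyform G x y)^-1 B w /\
      consistent (induced_sub G S) B w.
Proof.
move=> p_gt0 q_gt0 r_gt0 s_gt0 tails_sub heads_sub disjTH x_ge0 y_ge0 nx ny xy_max.
set l := polyform G x y => l_gt0.
pose S := [set u in tails G | 0 < x u] :|: [set v in heads G | 0 < y v].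
have S_sub : S \subset vset G.
  rewrite finset.subUset; apply/andP; split; apply/fintype.subsetP => u;
    rewrite inE => /andP[+ _].
    exact/fintype.subsetP.
  exact/fintype.subsetP.
exists S => //; set G' := induced_sub G S.
(* Disjointness of tails and heads, which the bipartite split provides, makes membership of a tail
   vertex in [S] depend on [x] alone. *)
have ST u : u \in tails G -> (u \in S) = (0 < x u).
  by move=> uT; rewrite !inE uT /= (disjointFr disjTH uT) /= orbF.
have SH v : v \in heads G -> (v \in S) = (0 < y v).
  by move=> vH; rewrite !inE vH /= (disjointFl disjTH vH).
have G'G e : e \in arcs G' -> e \in arcs G by rewrite inE => /andP[].
have x_gt0 u e : e \in arcs G' -> u \in e.1 -> 0 < x u.
  rewrite inE => /and3P[eG /fintype.subsetP sub _] ue.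
  by rewrite -ST ?sub//; exact: arctail_sub ue.
have y_gt0 v e : e \in arcs G' -> v \in e.2 -> 0 < y v.
  rewrite inE => /and3P[eG _ /fintype.subsetP sub] ve.
  by rewrite -SH ?sub//; exact: archead_sub ve.
pose P (e : darc V) := \prod_(u in e.1) x u * \prod_(v in e.2) y v.
pose w e := P e / l.
have P_gt0 e : e \in arcs G' -> 0 < P e.
  move=> eG'; rewrite mulr_gt0// prodr_gt0// => u ue.
    exact: x_gt0 eG' ue.
  exact: y_gt0 eG' ue.
have w_gt0 e : e \in arcs G' -> 0 < w e by move=> /P_gt0 ?; rewrite divr_gt0.
have P_eq0 e : e \in arcs G -> e \notin arcs G' -> P e = 0.
  move=> eG; rewrite inE eG /= negb_and => /orP[] /subsetPn[u ue].
    rewrite ST ?(arctail_sub eG ue)// -leNgt => xu.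
    by rewrite /P (bigD1 u)//= [x u](@le_anti _ _ _ 0) ?xu ?x_ge0// !mul0r.
  rewrite SH ?(archead_sub eG ue)// -leNgt => yu.
  by rewrite /P (bigD1 u ue)/= [y u](@le_anti _ _ _ 0) ?yu ?y_ge0// mul0r mulr0.
(* Arcs outside the support have a vanishing monomial, so stationarity on [G] carries over to
   [G']. *)
have sum_supp (Q : pred (darc V)) :
    \sum_(e in arcs G' | Q e) w e = (\sum_(e in arcs G | Q e) P e) / l.
  rewrite mulr_suml [RHS](bigID (mem (arcs G')))/= [X in _ + X]big1 ?addr0.
    apply: eq_bigl => e; rewrite andbAC; congr (_ && _).
    by apply/idP/andP => [eG'|[]//]; rewrite (G'G e eG').
  by move=> e /andP[/andP[eG _] eG']; rewrite P_eq0// mul0r.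
have sumx := (pnorm_eq1 (tails G) x p_gt0).1 nx.
have sumy := (pnorm_eq1 (heads G) y q_gt0).1 ny.
(* With [y] fixed, the form is multilinear in [x], the head products being its coefficients. *)
have statT u : u \in tails G ->
    \sum_(e in arcs G' | u \in e.1) w e = r%:R * x u `^ p.
  move=> uT; have polyformC x' : polyform G x' y =
      \sum_(e in arcs G) \prod_(v in e.2) y v * \prod_(u in e.1) x' u.
    by apply: eq_bigr => e _; rewrite mulrC.
  rewrite sum_supp (eq_bigr (fun e : darc V =>
    \prod_(v in e.2) y v * \prod_(u in e.1) x u)) => [|e _]; last exact: mulrC.
  rewrite (@multilinear_stationary R V _ (arcs G) (fun e => e.1) r (tails G) p
    (fun e => \prod_(v in e.2) y v) x u p_gt0) //.
  - by rewrite -polyformC -/l (ger0_norm (x_ge0 u)) mulfK// gt_eqF.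
  - by move=> e /arc_structure[].
  - move=> x' /(pnorm_eq1 _ _ p_gt0) nx'; have := xy_max x' y nx' ny.
    by rewrite !polyformC.
have statH v : v \in heads G ->
    \sum_(e in arcs G' | v \in e.2) w e = s%:R * y v `^ q.
  move=> vH; rewrite sum_supp.
  rewrite (@multilinear_stationary R V _ (arcs G) (fun e => e.2) s (heads G) q
    (fun e => \prod_(u in e.1) x u) y v q_gt0) //.
  - by rewrite -/(polyform G x y) -/l (ger0_norm (y_ge0 v)) mulfK// gt_eqF.
  - by move=> e /arc_structure[].
  - by move=> y' /(pnorm_eq1 _ _ q_gt0) ny'; exact: xy_max nx ny'.
pose B v (e : darc V) := if v \in e.1 then w e / (r%:R * x v `^ p)
  else if v \in e.2 then w e / (s%:R * y v `^ q) else 0.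
have BT u (e : darc V) : u \in e.1 -> B u e = w e / (r%:R * x u `^ p).
  by move=> ue; rewrite /B ue.
have BH v e : e \in arcs G' -> v \in e.2 -> B v e = w e / (s%:R * y v `^ q).
  move=> eG' ve; have [_ _ disj_e _ _] := arc_structure eG'.
  by rewrite /B (disjointFl disj_e ve) ve.
have rx_gt0 u e : e \in arcs G' -> u \in e.1 -> 0 < r%:R * x u `^ p.
  by move=> eG' ue; rewrite mulr_gt0 ?ltr0n// powR_gt0//; exact: x_gt0 eG' ue.
have sy_gt0 v e : e \in arcs G' -> v \in e.2 -> 0 < s%:R * y v `^ q.
  by move=> eG' ve; rewrite mulr_gt0 ?ltr0n// powR_gt0//; exact: y_gt0 eG' ve.
exists B, w; split; first split=> //.
- move=> v e _ eG'; split=> [/setUP[ve|ve]|].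
  + by rewrite BT// divr_gt0 ?w_gt0//; exact: rx_gt0 eG' ve.
  + by rewrite BH// divr_gt0 ?w_gt0//; exact: sy_gt0 eG' ve.
  + by rewrite inE negb_or /B => /andP[/negPf-> /negPf->].
- have := sum_supp predT; rewrite -/l.
  under eq_bigl do rewrite andbT.
  under [X in _ = X / _]eq_bigl do rewrite andbT.
  by move=> ->; rewrite -/(polyform G x y) divff// gt_eqF.
- split=> u /bigcupP[e eG' ue].
    under eq_bigr => f /andP[_ uf] do rewrite BT//.
    rewrite -mulr_suml statT ?divff//; first by rewrite gt_eqF// (rx_gt0 u e).
    exact: arctail_sub (G'G e eG') ue.
  under eq_bigr => f /andP[fG' uf] do rewrite BH//.
  rewrite -mulr_suml statH ?divff//; first by rewrite gt_eqF// (sy_gt0 u e).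
  exact: archead_sub (G'G e eG') ue.
- move=> e eG'; have [_ _ _ card1 card2] := arc_structure eG'.
  have we := w_gt0 e eG'.
  under eq_bigr => u ue do rewrite BT//.
  under [X in _ * X]eq_bigr => v ve do rewrite BH//.
  rewrite !prod_edge_weight ?ltW//; try by move=> *; exact: powR_ge0.
  rewrite (eq_bigr x) => [|u ue]; last first.
    by rewrite -powRrM mulfV ?gt_eqF// powRr1.
  rewrite [X in _ / (s%:R `^ _ * X)](eq_bigr y) => [|v ve]; last first.
    by rewrite -powRrM mulfV ?gt_eqF// powRr1.
  have w0 : w e != 0 by rewrite gt_eqF.
  rewrite powRB ?w0 ?implybT// powRr1 ?(ltW we)// powRD ?w0 ?implybT//.
  have b1 : \prod_(u in e.1) x u != 0.
    by rewrite gt_eqF// prodr_gt0// => u; exact: x_gt0.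
  have b2 : \prod_(v in e.2) y v != 0.
    by rewrite gt_eqF// prodr_gt0// => u; exact: y_gt0.
  have rr : r%:R `^ (r%:R / p) != 0 :> R by rewrite gt_eqF// powR_gt0// ltr0n.
  have ss : s%:R `^ (s%:R / q) != 0 :> R by rewrite gt_eqF// powR_gt0// ltr0n.
  have wr : w e `^ (r%:R / p) != 0 by rewrite gt_eqF// powR_gt0.
  have ws : w e `^ (s%:R / q) != 0 by rewrite gt_eqF// powR_gt0.
  have l0 : l != 0 by rewrite gt_eqF.
  have wE : w e = \prod_(u in e.1) x u * \prod_(v in e.2) y v / l by [].
  (* Only the isolated factor [w e] is expanded; its powers with exponents [r / p] and [s / q] stay
     as atoms and cancel. *)
  rewrite {1}wE; move: b1 b2 rr ss wr ws l0 {wE we}.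
  move: (\prod_(_ in e.1) _) (\prod_(_ in e.2) _) (r%:R `^ _) (s%:R `^ _).
  move: (w e `^ (r%:R / p)) (w e `^ (s%:R / q)) => a1 a2 a3 a4 a5 a6.
  by move=> *; field; do ?[apply/andP; split].
- have divKl (a b : R) : 0 < a -> a / (a / b) = b.
    by move=> a_gt0; rewrite invf_div mulrCA divff ?mulr1// gt_eqF.
  split=> u e f _ eG' fG' ue uf; first by rewrite !BT// !divKl ?w_gt0.
  by rewrite !BH// !divKl ?w_gt0.
Qed.

(** * Transfer to the bipartite split *)

Lemma split_arc_inj (V : finType) : injective (@split_arc V).
Proof.
move=> [t1 h1] [t2 h2] [].
by move=> /(imset_inj inl_inj) -> /(imset_inj inr_inj) ->.
Qed.

Lemma tails_bsplit (r s : nat) (V : finType) (G : dirhypergraph r s V) :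
  tails (bsplit G) = inl @: tails G.
Proof.
apply/setP => i; apply/bigcupP/imsetP => [[_ /imsetP[e eG ->]]|[u]].
  by move=> /imsetP[u ue ->]; exists u => //; exact: arctail_sub ue.
move=> /bigcupP[e eG ue] ->; exists (split_arc e); first exact: imset_f.
exact: imset_f.
Qed.

Lemma heads_bsplit (r s : nat) (V : finType) (G : dirhypergraph r s V) :
  heads (bsplit G) = inr @: heads G.
Proof.
apply/setP => i; apply/bigcupP/imsetP => [[_ /imsetP[e eG ->]]|[u]].
  by move=> /imsetP[u ue ->]; exists u => //; exact: archead_sub ue.
move=> /bigcupP[e eG ue] ->; exists (split_arc e); first exact: imset_f.
exact: imset_f.
Qed.

Lemma pnorm_imset (R : realType) (V W : finType) (f : V -> W) (A : {set V})
    (p : R) (x : W -> R) : injective f -> pnorm (f @: A) p x = pnorm A p (x \o f).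
Proof. by move=> f_inj; rewrite /pnorm big_imset //= => u v _ _ /f_inj. Qed.

Lemma polyform_bsplit (R : realType) (r s : nat) (V : finType)
    (G : dirhypergraph r s V) (x y : V + V -> R) :
  polyform (bsplit G) x y = polyform G (x \o inl) (y \o inr).
Proof.
rewrite /polyform big_imset /=; last by move=> e f _ _; exact: split_arc_inj.
apply: eq_bigr => e _; congr (_ * _); rewrite big_imset //= => u v _ _.
  exact: inl_inj.
exact: inr_inj.
Qed.

(** The vectors [x] and [y] are indexed independently even where tails and heads of [G] overlap, so
    separating the two roles of a vertex changes no value of the form. *)
Lemma polyform_values_bsplit (R : realType) (r s : nat) (V : finType)
    (G : dirhypergraph r s V) (p q : R) :
  polyform_values (bsplit G) p q = polyform_values G p q.
Proof.
apply/seteqP; split=> c [x [y [nx ny ->]]].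
  exists (x \o inl), (y \o inr); rewrite -polyform_bsplit.
  rewrite -(pnorm_imset _ _ _ inl_inj) -(pnorm_imset _ _ _ inr_inj).
  by rewrite -tails_bsplit -heads_bsplit.
(* Each vector is copied to both summands; only the [inl] values of the first and the [inr] values
   of the second are read. *)
exists (fun i => match i with inl u => x u | inr v => x v end).
exists (fun i => match i with inl u => y u | inr v => y v end).
rewrite polyform_bsplit tails_bsplit heads_bsplit.
by rewrite (pnorm_imset _ _ _ inl_inj) (pnorm_imset _ _ _ inr_inj).
Qed.

(** * The spectral value as a maximum over labelings *)

Lemma lambda_eq (R : realType) (r s : nat) (V : finType)
    (G : dirhypergraph r s V) (p q l : R) :
  is_maximum (polyform_values G p q) l -> lambda G p q = l.
Proof.
move=> l_max; apply: xget_unique => // m [m_val m_ub].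
by case: l_max => l_val l_ub; apply/le_anti; rewrite l_ub// m_ub.
Qed.

(** At least one arc is assumed: without arcs the weights sum to 0 instead of 1, and no labeling
    exists. *)
Theorem theorem4p23 (R : realType) (r s : nat) (V : finType)
    (G : dirhypergraph r s V) (p q : R)
    (r_gt0 : (0 < r)%N) (s_gt0 : (0 < s)%N) (G_arcs : (0 < #|arcs G|)%N)
    (p_ge1 : 1 <= p) (q_ge1 : 1 <= q) (hyp : 1 < r%:R / p + s%:R / q) :
  (exists2 S : {set V + V}, S \subset vset (bsplit G) &
     hyperbolic_consistent_normal (induced_sub (bsplit G) S) p q
       (r%:R `^ (r%:R / p) * s%:R `^ (s%:R / q) * lambda G p q)^-1) /\
  (exists2 m : R,
     is_maximum
       [set m | exists2 alpha : R,
          (exists2 S : {set V + V}, S \subset vset (bsplit G) &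
             hyperbolic_consistent_normal (induced_sub (bsplit G) S) p q alpha) &
          m = alpha^-1]%classic m &
     lambda G p q = 1 / (r%:R `^ (r%:R / p) * s%:R `^ (s%:R / q)) * m).
Proof.
have p_gt0 : 0 < p := lt_le_trans ltr01 p_ge1.
have q_gt0 : 0 < q := lt_le_trans ltr01 q_ge1.
have H_arcs : (0 < #|arcs (bsplit G)|)%N.
  by rewrite card_imset//; exact: split_arc_inj.
have [x [y [[x_ge0 y_ge0] nx ny xy_max xy_gt0]]] :=
  exists_maximizer p_gt0 q_gt0 r_gt0 s_gt0 H_arcs.
have lambdaE : lambda G p q = polyform (bsplit G) x y.
  apply: lambda_eq; rewrite -polyform_values_bsplit; split; first by exists x, y.
  by move=> _ [x' [y' [nx' ny' ->]]]; exact: xy_max.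
have disjTH : [disjoint tails (bsplit G) & heads (bsplit G)].
  rewrite tails_bsplit heads_bsplit disjoint_subset.
  apply/fintype.subsetP => _ /imsetP[u _ ->].
  by rewrite inE; apply/imsetP => -[].
have subT : tails (bsplit G) \subset vset (bsplit G).
  by rewrite tails_bsplit finset.subsetUl.
have subH : heads (bsplit G) \subset vset (bsplit G).
  by rewrite heads_bsplit finset.subsetUr.
set C := _ * s%:R `^ (s%:R / q).
have C_gt0 : 0 < C by rewrite mulr_gt0// powR_gt0// ltr0n.
have labeling : exists2 S : {set V + V}, S \subset vset (bsplit G) &
    hyperbolic_consistent_normal (induced_sub (bsplit G) S) p q
      (C * lambda G p q)^-1.
  have [S S_sub [B [w Bw]]] := maximizer_labeling p_gt0 q_gt0 r_gt0 s_gt0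
    subT subH disjTH x_ge0 y_ge0 nx ny xy_max xy_gt0.
  by exists S => //; split=> //; exists B, w; rewrite lambdaE.
(* The labeling just built attains [C * lambda G p q]; any other labeling has [alpha^-1] at most [C]
   times some value of the form, hence at most this number. *)
split=> //; exists (C * lambda G p q).
  split; first by exists (C * lambda G p q)^-1; rewrite ?invrK.
  move=> _ [alpha [S S_sub [_ [B [w [Bw_normal Bw_cons]]]]] ->].
  have [x' [y' [nx' ny' /le_trans]]] :=
    labeling_le_polyform p_gt0 q_gt0 r_gt0 s_gt0 Bw_normal Bw_cons.
  by apply; rewrite ler_pM2l// lambdaE xy_max.
by rewrite div1r mulKf// gt_eqF.
Qed.
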